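(* Let $F$ be a real hyperfield and let $v$ be a valuation on $F$ with value group $\Gamma$ and residue hyperfield $\overline F=\mathcal O_v/\mathcal M_v$. Let $\mathcal X(F,v)$ be the set of all orderings of $F$ compatible with $v$, let $\mathcal X(\overline F)$ be the set of all orderings of $\overline F$, and let $\operatorname{Hom}(\Gamma,\{1,-1\})$ be the set of group homomorphisms from $\Gamma$ to the multiplicative group $\{1,-1\}$. Then there is a bijection between $\mathcal X(F,v)$ and $\mathcal X(\overline F)\times\operatorname{Hom}(\Gamma,\{1,-1\})$.
   Context: Hyperoperations. A hyperoperation $+$ on a nonempty set $H$ assigns to each $(x,y)\in H\times H$ a nonempty subset $x+y\subseteq H$. For subsets $A,B\subseteq H$, $A+B=\bigcup_{a\in A,b\in B}(a+b)$; an element is identified with its singleton where convenient. A canonical hypergroup is $(H,+,0)$ with $+$ a hyperoperation that is associative and commutative, such that for every $x$ there is a unique $-x$ with $0\in x+(-x)$, and such that $z\in x+y$ implies $y\in z-x:=z+(-x)$. A (commutative) hyperring is $(R,+,\cdot,0)$ with $(R,+,0)$ a canonical hypergroup, $(R,\cdot)$ a commutative semigroup with $x\cdot 0=0$, and $x(y+z)=xy+xz$ as sets. A hyperfield is a hyperring $F$ with multiplicative unity $1\neq 0$ such that $F^\times=F\setminus\{0\}$ is a group under multiplication. An ordering of a hyperfield $F$ is a subset $P\subseteq F$ with $P+P\subseteq P$, $P\cdot P\subseteq P$, $P\cap -P=\emptyset$, $P\cup -P=F^\times$. $F$ is real if it has at least one ordering. A valuation on $F$ is a map $v:F\to\Gamma\cup\{\infty\}$,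 $\Gamma$ a (linearly) ordered abelian group written additively, with: $v(a)=\infty$ iff $a=0$; $v(ab)=v(a)+v(b)$; $c\in a+b\Rightarrow v(c)\ge\min\{v(a),v(b)\}$. Its value group is $v(F^\times)$. Put $\mathcal O_v=\{x: v(x)\ge 0\}$, $\mathcal M_v=\{x: v(x)>0\}$. The residue hyperfield $\overline F=\mathcal O_v/\mathcal M_v$ consists of the classes $x+\mathcal M_v$ ($x\in\mathcal O_v$) of the equivalence relation $x\sim y\iff (x-y)\cap\mathcal M_v\ne\emptyset$, with $(x+\mathcal M_v)+(y+\mathcal M_v)=\{z+\mathcal M_v: z\in x+y\}$ and $(x+\mathcal M_v)(y+\mathcal M_v)=xy+\mathcal M_v$. Compatibility: $v$ and an ordering $P$ of $F$ are compatible if $1+\mathcal M_v\subseteq P$ (this is one of several equivalent conditions by which the paper defines compatibility; another is that $\{a+\mathcal M_v: a\in P,\ v(a)=0\}$ is an ordering of $\overline F$). *)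

(* Defs.v *)
From HB Require Import structures.
From mathcomp Require Import all_boot all_order all_algebra.
From mathcomp Require Import boolp classical_sets functions.
Set Implicit Arguments.
Unset Strict Implicit.
Unset Printing Implicit Defensive.
Import Order.TTheory GRing.Theory Num.Theory.
Local Open Scope classical_set_scope.

Declare Scope hyper_scope.
Delimit Scope hyper_scope with H.

(* The extension of a hyperoperation to subsets. *)
Definition set_hop (T : Type) (op : T -> T -> set T) (A B : set T) : set T :=
  \bigcup_(a in A) \bigcup_(b in B) op a b.

(* The unique inverse is part of the structure: [0 \in x + y] holds exactly
   when [y = - x].  Neutrality of 0 is not an axiom; it follows (lemma haddx0). *)
HB.mixin Record isCanonicalHypergroup H := {
  hzero : H;
  hopp : H -> H;
  hadd : H -> H -> set H;
  hadd_neq0 : forall x y, hadd x y !=set0;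
  haddA : forall x y z,
    set_hop hadd (hadd x y) [set z] = set_hop hadd [set x] (hadd y z);
  haddC : forall x y, hadd x y = hadd y x;
  haddxN : forall x, hadd x (hopp x) hzero;
  hopp_uniq : forall x y, hadd x y hzero -> y = hopp x;
  hadd_rev : forall x y z, hadd x y z -> hadd z (hopp x) y
}.

HB.structure Definition CanonicalHypergroup := { H of isCanonicalHypergroup H }.
Notation canonicalHypergroupType := CanonicalHypergroup.type.

HB.mixin Record CanonicalHypergroup_isHyperring R of CanonicalHypergroup R := {
  hmul : R -> R -> R;
  hmulA : forall x y z, hmul x (hmul y z) = hmul (hmul x y) z;
  hmulC : forall x y, hmul x y = hmul y x;
  hmulx0 : forall x, hmul x hzero = hzero;
  hmulDr : forall x y z,
    [set hmul x w | w in hadd y z] = hadd (hmul x y) (hmul x z)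
}.

HB.structure Definition Hyperring :=
  { R of CanonicalHypergroup R & CanonicalHypergroup_isHyperring R }.
Notation hyperringType := Hyperring.type.

(* Closure of the nonzero elements under multiplication follows from the
   existence of inverses. *)
HB.mixin Record Hyperring_isHyperfield F of Hyperring F := {
  hone : F;
  hmul1x : forall x, hmul hone x = x;
  hone_neq0 : hone <> hzero;
  hinv_ex : forall x, x <> hzero -> exists y, hmul x y = hone
}.

HB.structure Definition Hyperfield :=
  { F of Hyperring F & Hyperring_isHyperfield F }.
Notation hyperfieldType := Hyperfield.type.

Arguments hzero {s}.
Arguments hone {s}.

Notation "0" := (hzero) : hyper_scope.
Notation "1" := (hone) : hyper_scope.
Notation "- x" := (hopp x) : hyper_scope.
Notation "- 1" := (hopp hone) : hyper_scope.
Notation "x + y" := (hadd x y) : hyper_scope.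
Notation "x - y" := (hadd x (hopp y)) : hyper_scope.
Notation "x * y" := (hmul x y) : hyper_scope.

Section HyperTheory.
Local Open Scope hyper_scope.

Lemma hoppK (H : canonicalHypergroupType) (x : H) : - - x = x.
Proof. by apply/esym/hopp_uniq; rewrite haddC; apply: haddxN. Qed.

Lemma haddx0 (H : canonicalHypergroupType) (x : H) : x + 0 = [set x].
Proof.
apply/seteqP; split=> z /=.
  by move/hadd_rev/hopp_uniq/(congr1 hopp); rewrite !hoppK.
by move=> ->; have /hadd_rev := haddxN (- x); rewrite hoppK haddC.
Qed.

Lemma hopp0 (H : canonicalHypergroupType) : - (0 : H) = 0.
Proof. by apply/esym/hopp_uniq; rewrite haddx0. Qed.

Lemma hadd_revr (H : canonicalHypergroupType) (x y z : H) :
  (x + y)%H z -> (z - y)%H x.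
Proof. by rewrite haddC => /hadd_rev. Qed.

Lemma hsub_rev (H : canonicalHypergroupType) (x y z : H) :
  (x - y)%H z -> (z + y)%H x.
Proof. by move/hadd_revr; rewrite hoppK. Qed.

Lemma hadd_assoc (H : canonicalHypergroupType) (x y z w u : H) :
  (x + y)%H w -> (w + z)%H u -> exists2 t, (y + z)%H t & (x + t)%H u.
Proof.
move=> xyw wzu; have : set_hop hadd (x + y) [set z] u.
  by exists w => //; exists z.
by rewrite haddA => -[_ ->] [t yzt xtu]; exists t.
Qed.

Lemma hadd_assocr (H : canonicalHypergroupType) (x y z t u : H) :
  (y + z)%H t -> (x + t)%H u -> exists2 w, (x + y)%H w & (w + z)%H u.
Proof.
move=> yzt xtu; have : set_hop hadd [set x] (y + z)%H u.
  by exists x => //; exists t.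
by rewrite -haddA => -[w xyw] [_ -> wzu]; exists w.
Qed.

(* [- (x + y) = - x - y] *)
Lemma hoppD (H : canonicalHypergroupType) (x y z : H) :
  (x + y)%H z -> (- x - y)%H (- z)%H.
Proof.
move=> xyz; have h1 := haddxN z.
have [t h2 /hopp_uniq h3] := hadd_assoc xyz h1.
by apply: hadd_rev; rewrite -h3.
Qed.

Lemma hmul0x (R : hyperringType) (x : R) : 0 * x = 0.
Proof. by rewrite hmulC hmulx0. Qed.

Lemma hmulDl_mem (R : hyperringType) (x y z w : R) :
  (y + z)%H w -> (x * y + x * z)%H (x * w)%H.
Proof. by rewrite -hmulDr; exists w. Qed.

Lemma hmulxN (R : hyperringType) (x y : R) : x * - y = - (x * y).
Proof.
by apply: hopp_uniq; rewrite -[X in _ X](hmulx0 x); apply/hmulDl_mem/haddxN.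
Qed.

Lemma hmulx1 (F : hyperfieldType) (x : F) : x * 1 = x.
Proof. by rewrite hmulC hmul1x. Qed.

Lemma hmulNN (R : hyperringType) (x y : R) : - x * - y = x * y.
Proof. by rewrite hmulxN hmulC hmulxN hoppK hmulC. Qed.

End HyperTheory.

Section Orderings.
Local Open Scope hyper_scope.

Definition is_ordering (F : hyperfieldType) (P : set F) : Prop :=
  [/\ set_hop hadd P P `<=` P,
      [set x * y | x in P & y in P] `<=` P,
      P `&` [set - x | x in P] = set0
    & P `|` [set - x | x in P] = [set x | x <> 0]].

Definition orderings (F : hyperfieldType) : set (set F) :=
  [set P | is_ordering P].

Definition is_real (F : hyperfieldType) : Prop := exists P : set F, is_ordering P.

End Orderings.

Arguments orderings : clear implicits.

(* Linearly ordered abelian groups.  [porderZmodType] does not relate the order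
   to the addition. *)
Record orderedZmodType := OrderedZmodType {
  ozmod_sort :> porderZmodType;
  ozmod_total : forall x y : ozmod_sort, (x <= y)%R || (y <= x)%R;
  ozmod_le_add2l : forall x y z : ozmod_sort, (x <= y -> z + x <= z + y)%R
}.

Variant with_infty (G : Type) : Type := Fin of G | Infty.
Arguments Fin {G}.
Arguments Infty {G}.

Section WithInfty.
Variable G : orderedZmodType.
Implicit Types a b : with_infty G.
Local Open Scope ring_scope.

Definition wi_add a b : with_infty G :=
  match a, b with Fin x, Fin y => Fin (x + y) | _, _ => Infty end.

Definition wi_le a b : bool :=
  match a, b with
  | _, Infty => true
  | Infty, Fin _ => false
  | Fin x, Fin y => x <= y
  end.

Definition wi_lt a b : bool :=
  match a, b with
  | Infty, _ => false
  | Fin _, Infty => true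
  | Fin x, Fin y => x < y
  end.

Definition wi_min a b : with_infty G := if wi_le a b then a else b.

End WithInfty.

Record valuation (F : hyperfieldType) (G : orderedZmodType) := Valuation {
  val_fun :> F -> with_infty G;
  val_infty : forall x, val_fun x = Infty <-> x = 0%H;
  val_mul : forall x y, val_fun (x * y)%H = wi_add (val_fun x) (val_fun y);
  val_add : forall x y z, (x + y)%H z ->
    wi_le (wi_min (val_fun x) (val_fun y)) (val_fun z)
}.

Section Residue.
Variables (F : hyperfieldType) (G : orderedZmodType) (v : valuation F G).
Local Open Scope hyper_scope.

Definition value_group : set G := [set g | exists2 x, x <> 0 & v x = Fin g].

Definition val_ring : set F := [set x | wi_le (Fin 0%R) (v x)].

Definition val_ideal : set F := [set x | wi_lt (Fin 0%R) (v x)].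

Definition residue_eqv (x y : F) : Prop := (x - y) `&` val_ideal !=set0.

Definition residue_set (x : F) : set F :=
  [set y | val_ring y /\ residue_eqv x y].

(* The quotient is the set of equivalence classes in [val_ring]. *)
Definition residue : Type :=
  {C : set F | exists2 x, val_ring x & C = residue_set x}.

Definition residue_class (x : F) (Ox : val_ring x) : residue :=
  exist _ (residue_set x) (ex_intro2 _ _ x Ox erefl).

Local Notation O := val_ring.
Local Notation M := val_ideal.

Lemma val0 : v 0 = Infty. Proof. exact/val_infty. Qed.

Lemma val1 : v 1 = Fin 0%R.
Proof.
have := val_mul v 1 1; rewrite hmul1x; case E : (v 1) => [a|] /=.
  by case=> /eqP; rewrite -subr_eq0 opprD addNKr oppr_eq0 => /eqP ->.
by move/val_infty: E => /hone_neq0.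
Qed.

Lemma val_opp1 : v (- 1) = Fin 0%R.
Proof.
have := val_mul v (- 1) (- 1); rewrite hmulNN hmul1x val1.
case: (v (- 1)) => [a|] //= [/esym aa0]; congr Fin.
have [a0|a0] := orP (ozmod_total 0%R a); apply/eqP; rewrite eq_le.
  by have := ozmod_le_add2l a a0; rewrite aa0 addr0 a0 => ->.
by have := ozmod_le_add2l a a0; rewrite aa0 addr0 a0 => ->.
Qed.

Lemma val_opp x : v (- x) = v x.
Proof.
rewrite -{1}(hmulx1 x) -hmulxN val_mul val_opp1.
by case: (v x) => //= a; rewrite addr0.
Qed.

Lemma val_idealW x : M x -> O x.
Proof. by rewrite /val_ring /val_ideal /=; case: (v x) => //= a /ltW. Qed.

Lemma val_ring0 : O 0. Proof. by rewrite /val_ring /= val0. Qed.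
Lemma val_ideal0 : M 0. Proof. by rewrite /val_ideal /= val0. Qed.
Lemma val_ring1 : O 1. Proof. by rewrite /val_ring /= val1 /=. Qed.

Lemma val_ringN x : O x -> O (- x).
Proof. by rewrite /val_ring /= val_opp. Qed.

Lemma val_idealN x : M x -> M (- x).
Proof. by rewrite /val_ideal /= val_opp. Qed.

Lemma val_ringD x y z : O x -> O y -> (x + y)%H z -> O z.
Proof.
rewrite /val_ring /= => Ox Oy /(val_add v); rewrite /wi_min.
case: ifP => _; move: Ox Oy; case: (v x) => [a|]; case: (v y) => [b|];
  case: (v z) => //= c a0 b0 h; by apply: le_trans h.
Qed.

Lemma val_idealD x y z : M x -> M y -> (x + y)%H z -> M z.
Proof.
rewrite /val_ideal /= => Mx My /(val_add v); rewrite /wi_min.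
case: ifP => _; move: Mx My; case: (v x) => [a|]; case: (v y) => [b|];
  case: (v z) => //= c a0 b0 h; by apply: lt_le_trans h.
Qed.

Lemma val_ringM x y : O x -> O y -> O (x * y).
Proof.
rewrite /val_ring /= val_mul; case: (v x) (v y) => [a|] [b|] //= a0 b0.
by apply: le_trans a0 _; have := ozmod_le_add2l a b0; rewrite addr0.
Qed.

Lemma val_idealM x y : O x -> M y -> M (x * y).
Proof.
rewrite /val_ring /val_ideal /= val_mul.
case: (v x) (v y) => [a|] [b|] //= a0 b0.
apply: lt_le_trans b0 _; have := ozmod_le_add2l b a0.
by rewrite addr0 addrC.
Qed.

Lemma residue_eqv_refl x : residue_eqv x x.
Proof. by exists 0; split; [exact: haddxN | exact: val_ideal0]. Qed.

Lemma residue_eqv_sym x y : residue_eqv x y -> residue_eqv y x.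
Proof.
move=> [m [xym Mm]]; exists (- m); split; last exact: val_idealN.
by have := hoppD xym; rewrite hoppK haddC.
Qed.

Lemma residue_eqv_trans y x z :
  residue_eqv x y -> residue_eqv y z -> residue_eqv x z.
Proof.
move=> [m [/hsub_rev xym Mm]] [n [/hsub_rev yzn Mn]].
have [k mnk kzx] := hadd_assocr yzn xym.
by exists k; split; [apply: hadd_revr kzx | apply: val_idealD mnk].
Qed.

Lemma residue_eqv0 x : residue_eqv x 0 <-> M x.
Proof.
rewrite /residue_eqv hopp0 haddx0; split; first by move=> [_ [-> ]].
by move=> Mx; exists x.
Qed.

Lemma residue_class_eq x y (Ox : O x) (Oy : O y) :
  residue_class Ox = residue_class Oy <-> residue_eqv x y.
Proof.
split=> [/(congr1 sval) /= E|xy].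
  have : residue_set y y by split=> //; exact: residue_eqv_refl.
  by rewrite -E => -[].
apply: eq_exist; apply/seteqP; split=> z [Oz xz]; split=> //.
  exact: residue_eqv_trans (residue_eqv_sym xy) xz.
exact: residue_eqv_trans xy xz.
Qed.

Definition residue_repr (C : residue) : F := s2val (cid2 (svalP C)).

Lemma residue_repr_ring C : O (residue_repr C).
Proof. exact: s2valP (cid2 (svalP C)). Qed.

Lemma residue_reprK C : residue_class (residue_repr_ring C) = C.
Proof.
have : sval C = residue_set (residue_repr C) := s2valP' (cid2 (svalP C)).
by move: (residue_repr_ring C); move: (residue_repr C); case: C => A EA x Ox /= E;
  apply/eq_exist.
Qed.

Lemma residue_reprE x (Ox : O x) :
  residue_eqv (residue_repr (residue_class Ox)) x.
Proof. by apply/(residue_class_eq (residue_repr_ring _)); rewrite residue_reprK. Qed.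

Lemma residueP (C : residue) : exists x (Ox : O x), C = residue_class Ox.
Proof.
by exists (residue_repr C), (residue_repr_ring C); rewrite residue_reprK.
Qed.

(* Operations through representatives; lemmas residue_addE, residue_oppE and
   residue_mulE give their values on arbitrary classes. *)
Definition residue_add (C D : residue) : set residue :=
  [set E | exists z (Oz : O z),
     (residue_repr C + residue_repr D)%H z /\ E = residue_class Oz].

Definition residue_opp (C : residue) : residue :=
  residue_class (val_ringN (residue_repr_ring C)).

Definition residue_mul (C D : residue) : residue :=
  residue_class (val_ringM (residue_repr_ring C) (residue_repr_ring D)).

Lemma residue_eqvD x x' y z :
  residue_eqv x x' -> (x + y)%H z -> exists2 z', (x' + y)%H z' & residue_eqv z z'.
Proof.
move=> [m [/hsub_rev xm Mm] xyz].
have [t h1 h2] := hadd_assoc xm xyz.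
by exists t => //; exists m; split=> //; apply: hadd_revr.
Qed.

Lemma residue_eqvN x y : residue_eqv x y -> residue_eqv (- x) (- y).
Proof.
move=> [m [xym Mm]]; exists (- m); split; last exact: val_idealN.
exact: hoppD.
Qed.

Lemma residue_eqvM x x' y y' : O x -> O y' ->
  residue_eqv x x' -> residue_eqv y y' -> residue_eqv (x * y) (x' * y').
Proof.
move=> Ox Oy' [m [xm Mm]] [n [yn Mn]]; apply: (@residue_eqv_trans (x * y')).
  exists (x * n); split; last exact: val_idealM.
  by rewrite -hmulxN; apply: hmulDl_mem.
exists (y' * m); split; last exact: val_idealM.
by rewrite ![_ * y']hmulC -hmulxN; apply: hmulDl_mem.
Qed.

Lemma residue_addE x y (Ox : O x) (Oy : O y) :
  residue_add (residue_class Ox) (residue_class Oy) =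
  [set E | exists z (Oz : O z), (x + y)%H z /\ E = residue_class Oz].
Proof.
have key a b a' b' z : O a' -> O b' -> residue_eqv a a' -> residue_eqv b b' ->
    (a + b)%H z -> exists z' (Oz' : O z'), (a' + b')%H z' /\ residue_eqv z z'.
  move=> Oa Ob aa bb abz; have [w abw zw] := residue_eqvD aa abz.
  rewrite haddC in abw; have [u abu wu] := residue_eqvD bb abw.
  rewrite haddC in abu; exists u, (val_ringD Oa Ob abu).
  by split=> //; apply: residue_eqv_trans wu.
apply/seteqP; split=> E [z [Oz [xyz ->]]].
  have [u [Ou [h ?]]] := key _ _ _ _ _ Ox Oy (residue_reprE _) (residue_reprE _) xyz.
  by exists u, Ou; split=> //; apply/residue_class_eq.
have [u [Ou [h ?]]] := key _ _ _ _ _ (residue_repr_ring _) (residue_repr_ring _)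
  (residue_eqv_sym (residue_reprE Ox)) (residue_eqv_sym (residue_reprE Oy)) xyz.
by exists u, Ou; split=> //; apply/residue_class_eq.
Qed.

Lemma residue_oppE x (Ox : O x) :
  residue_opp (residue_class Ox) = residue_class (val_ringN Ox).
Proof. exact/residue_class_eq/residue_eqvN/residue_reprE. Qed.

Lemma residue_mulE x y (Ox : O x) (Oy : O y) :
  residue_mul (residue_class Ox) (residue_class Oy) =
  residue_class (val_ringM Ox Oy).
Proof.
apply/residue_class_eq/residue_eqvM => //; first exact: residue_repr_ring.
all: exact: residue_reprE.
Qed.

Lemma residue_class_irr x (Ox Ox' : O x) : residue_class Ox = residue_class Ox'.
Proof. exact/residue_class_eq/residue_eqv_refl. Qed.

Let radd_neq0 C D : residue_add C D !=set0.
Proof.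
have [z h] := hadd_neq0 (residue_repr C) (residue_repr D).
have Oz := val_ringD (residue_repr_ring C) (residue_repr_ring D) h.
by exists (residue_class Oz), z, Oz.
Qed.

Let raddC C D : residue_add C D = residue_add D C.
Proof. by rewrite /residue_add haddC. Qed.

Let raddA C D E : set_hop residue_add (residue_add C D) [set E] =
  set_hop residue_add [set C] (residue_add D E).
Proof.
have [x [Ox ->]] := residueP C; have [y [Oy ->]] := residueP D.
have [z [Oz ->]] := residueP E; apply/seteqP; split=> W.
  move=> [A + [_ ->]]; rewrite residue_addE => -[w [Ow [xyw ->]]].
  rewrite residue_addE => -[u [Ou [wzu ->]]].
  have [t yzt xtu] := hadd_assoc xyw wzu; have Ot := val_ringD Oy Oz yzt.
  exists (residue_class Ox) => //; exists (residue_class Ot).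
    by rewrite residue_addE; exists t, Ot.
  by rewrite residue_addE; exists u, Ou.
move=> [_ -> [A +]]; rewrite residue_addE => -[t [Ot [yzt ->]]].
rewrite residue_addE => -[u [Ou [xtu ->]]].
have [w xyw wzu] := hadd_assocr yzt xtu; have Ow := val_ringD Ox Oy xyw.
exists (residue_class Ow); first by rewrite residue_addE; exists w, Ow.
by exists (residue_class Oz) => //; rewrite residue_addE; exists u, Ou.
Qed.

Let raddN C : residue_add C (residue_opp C) (residue_class val_ring0).
Proof.
have [x [Ox ->]] := residueP C; rewrite residue_oppE residue_addE.
by exists 0, val_ring0; split=> //; apply: haddxN.
Qed.

Let ropp_uniq C D : residue_add C D (residue_class val_ring0) ->
  D = residue_opp C.
Proof.
have [x [Ox ->]] := residueP C; have [y [Oy ->]] := residueP D.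
rewrite residue_oppE residue_addE => -[z [Oz [xyz]]].
move=> /residue_class_eq/residue_eqv_sym/residue_eqv0 Mz.
by apply/residue_class_eq; exists z; split=> //; rewrite hoppK haddC.
Qed.

Let radd_rev C D E : residue_add C D E -> residue_add E (residue_opp C) D.
Proof.
have [x [Ox ->]] := residueP C; have [y [Oy ->]] := residueP D.
rewrite residue_oppE residue_addE => -[z [Oz [xyz ->]]].
by rewrite residue_addE; exists y, Oy; split=> //; apply: hadd_rev.
Qed.

HB.instance Definition _ := isCanonicalHypergroup.Build residue
  radd_neq0 raddA raddC raddN ropp_uniq radd_rev.

Let rmulA C D E :
  residue_mul C (residue_mul D E) = residue_mul (residue_mul C D) E.
Proof.
have [x [Ox ->]] := residueP C; have [y [Oy ->]] := residueP D.
have [z [Oz ->]] := residueP E; rewrite !residue_mulE.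
by apply/residue_class_eq; rewrite hmulA; apply: residue_eqv_refl.
Qed.

Let rmulC C D : residue_mul C D = residue_mul D C.
Proof. by apply/residue_class_eq; rewrite hmulC; apply: residue_eqv_refl. Qed.

Let rmul0 C : residue_mul C 0 = 0.
Proof.
have [x [Ox ->]] := residueP C; rewrite residue_mulE.
by apply/residue_class_eq; rewrite hmulx0; apply: residue_eqv_refl.
Qed.

Let rmulDr C D E : [set residue_mul C W | W in D + E] =
  (residue_mul C D + residue_mul C E).
Proof.
have [x [Ox ->]] := residueP C; have [y [Oy ->]] := residueP D.
have [z [Oz ->]] := residueP E; rewrite !residue_mulE /hadd /= !residue_addE.
apply/seteqP; split=> U.
  move=> [_ [w [Ow [yzw ->]]] <-]; rewrite residue_mulE.
  by exists (x * w), (val_ringM Ox Ow); split=> //; apply: hmulDl_mem.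
move=> [u [Ou [+ ->]]]; rewrite -hmulDr => -[w yzw wu].
have Ow := val_ringD Oy Oz yzw.
exists (residue_class Ow); first by exists w, Ow.
by rewrite residue_mulE; apply/residue_class_eq; rewrite wu;
  apply: residue_eqv_refl.
Qed.

HB.instance Definition _ := CanonicalHypergroup_isHyperring.Build residue
  rmulA rmulC rmul0 rmulDr.

Let rmul1 C : residue_mul (residue_class val_ring1) C = C.
Proof.
have [x [Ox ->]] := residueP C; rewrite residue_mulE.
by apply/residue_class_eq; rewrite hmul1x; apply: residue_eqv_refl.
Qed.

Let rone_neq0 : residue_class val_ring1 <> 0.
Proof.
by move=> /residue_class_eq/residue_eqv0; rewrite /val_ideal /= val1 /= ltxx.
Qed.

Let rinv_ex (C : residue) : C <> 0 ->
  exists D, residue_mul C D = residue_class val_ring1.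
Proof.
have [x [Ox ->]] := residueP C => x0.
have NMx : ~ M x by move=> Mx; apply/x0/residue_class_eq/residue_eqv0.
have [y xy1] : exists y, x * y = 1.
  by apply: hinv_ex => E; apply: NMx; rewrite E; apply: val_ideal0.
have Oy : O y.
  have := val_mul v x y; rewrite xy1 val1; move: (Ox) NMx.
  rewrite /val_ring /val_ideal /=; case: (v x) (v y) => [a|] [b|] //= a0.
  rewrite lt_def a0 andbT => /negP; rewrite negbK => /eqP a00 [E].
  by rewrite E a00 add0r.
exists (residue_class Oy); rewrite residue_mulE.
by apply/residue_class_eq; rewrite xy1; apply: residue_eqv_refl.
Qed.

HB.instance Definition _ := Hyperring_isHyperfield.Build residue
  rmul1 rone_neq0 rinv_ex.

Definition compatible (P : set F) : Prop :=
  set_hop hadd [set 1] val_ideal `<=` P.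

Definition compatible_orderings : set (set F) :=
  [set P | is_ordering P /\ compatible P].

End Residue.

(* Group homomorphisms from G to the multiplicative group {1, -1}, as functions
   with values in the integers 1 and -1. *)
Definition sign_homs (G : zmodType) : set (G -> int) :=
  [set chi | (forall g, chi g = 1%R \/ chi g = (- 1)%R) /\
             (forall g h, chi (g + h)%R = (chi g * chi h)%R)].
Arguments sign_homs : clear implicits.

(* Main.v *)
Require Import Defs.
From mathcomp Require Import all_boot all_order all_algebra.
From mathcomp Require Import boolp classical_sets functions.
Local Open Scope classical_set_scope.

(** An ordering is determined by its sign homomorphism from the nonzero elements
to {1, -1}, so the theorem is about the way in which the group of nonzero
elements is put together from the units of the valuation and the value group.

The homomorphism v from the nonzero elements onto Gamma need not have a
multiplicative section, but it has one up to squares of units (sqr_section): a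
map p with v (p g) = g and p g * p h = p (g + h) * w^2.  It comes from Zorn's
lemma, applied to the multiplicative sets S of nonzero elements that contain
all nonzero squares and no other units than squares; a maximal one has all of Gamma as its image under v.  Every
nonzero x is then p (v x) * unit_part x, with a unit that is multiplicative in
x up to squares of units (unit_partM).  Signs do not see squares.

The bijection sends P to its image in the residue hyperfield together with the
homomorphism g |-> sign of p g (BK_map).
- It is well defined: compatibility says that a unit congruent to a positive
  one is positive, so positivity of a unit can be read off its residue class
  (residue_pos_image), and the image of P is an ordering.
- It is injective: the image of P gives the signs of all units, and together
  with the signs of the p g these give the signs of all nonzero elements.
- It is surjective: given Q and chi, let x have the sign of unit_part x in Q
  times chi (v x).  This sign is multiplicative and extends that of Q on
  units.  Closure under addition is automatic (ordering_of_sign_set): for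
  positive x and y with v x <= v y, the sum x + y is x times 1 + y / x, which
  consists of units with positive residue class. *)

Import Order.TTheory GRing.Theory Num.Theory.
Set Implicit Arguments.
Unset Strict Implicit.

(** * Multiplication and signs in a hyperfield *)

Section HyperfieldArithmetic.
Variable F : hyperfieldType.
Local Open Scope hyper_scope.
Implicit Types (x y z w : F) (D P : set F).

Definition hinv x : F :=
  if pselect (x <> 0) is left x0 then sval (cid (hinv_ex x x0)) else 0.

Lemma hmulxV x : x <> 0 -> x * hinv x = 1.
Proof. by rewrite /hinv; case: pselect => // x0 _; case: cid. Qed.

Lemma hinv_neq0 x : x <> 0 -> hinv x <> 0.
Proof. by move=> /hmulxV xV V0; apply: (@hone_neq0 F); rewrite -xV V0 hmulx0. Qed.

Lemma hmulKV x y : x <> 0 -> x * (hinv x * y) = y.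
Proof. by move=> /hmulxV xV; rewrite hmulA xV hmul1x. Qed.

Lemma hmulVK x y : x <> 0 -> hinv x * (x * y) = y.
Proof. by move=> /hmulxV xV; rewrite hmulA (hmulC (hinv x)) xV hmul1x. Qed.

Lemma hmul_neq0 x y : x <> 0 -> y <> 0 -> x * y <> 0.
Proof. by move=> x0 y0 xy; apply: y0; rewrite -(hmulVK y x0) xy hmulx0. Qed.

Lemma hopp_neq0 x : x <> 0 -> - x <> 0.
Proof. by move=> x0 /(congr1 hopp); rewrite hoppK hopp0. Qed.

Lemma hmulNx x y : - x * y = - (x * y).
Proof. by rewrite hmulC hmulxN hmulC. Qed.

Lemma hmulACA x y z w : (x * y) * (z * w) = (x * z) * (y * w).
Proof. by rewrite -!hmulA; congr hmul; rewrite !hmulA (hmulC y). Qed.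

(** The kernel of a homomorphism D -> {1, -1} that maps -1 to -1, where D is a
multiplicative set closed under opposites.  D is a parameter because both the
nonzero elements and the units of a valuation are needed. *)
Definition sign_set D P : Prop :=
  [/\ forall x y, P x -> P y -> P (x * y),
      forall x, P x -> D x /\ ~ P (- x)
    & forall x, D x -> P x \/ P (- x)].

Definition hsg P x : int := if `[< P x >] then 1%R else (-1)%R.

Lemma hsgT P x : P x -> hsg P x = 1%R.
Proof. by move=> Px; rewrite /hsg asboolT. Qed.

Lemma hsgF P x : ~ P x -> hsg P x = (-1)%R.
Proof. by move=> Px; rewrite /hsg asboolF. Qed.

Lemma hsg1 P x : hsg P x = 1%R <-> P x.
Proof. by rewrite /hsg; case: asboolP. Qed.

Lemma hsg_pm P x : hsg P x = 1%R \/ hsg P x = (-1)%R.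
Proof. by rewrite /hsg; case: asboolP; [left|right]. Qed.

Lemma eq_hsg P P' x : hsg P x = hsg P' x -> P x -> P' x.
Proof. by move=> e Px; apply/hsg1; rewrite -e; apply/hsg1. Qed.

Lemma hsgN D P x : sign_set D P -> D x -> hsg P (- x) = (- hsg P x)%R.
Proof.
move=> [_ PD DP] /DP[] Px; have [_ nPx] := PD _ Px.
  by rewrite (hsgF nPx) (hsgT Px).
by rewrite hoppK in nPx; rewrite (hsgF nPx) (hsgT Px) opprK.
Qed.

(** Each of the four sign cases reduces to closure of P under products, by
moving the opposites out of the product. *)
Lemma hsgM D P x y : sign_set D P -> D x -> D y ->
  hsg P (x * y) = (hsg P x * hsg P y)%R.
Proof.
move=> [PM PD DP] Dx Dy.
have neg z : P (- z) -> ~ P z by move=> /PD[_]; rewrite hoppK.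
case: (DP _ Dx) (DP _ Dy) => Px [] Py; have Pxy := PM _ _ Px Py.
- by rewrite !hsgT.
- by rewrite hmulxN in Pxy; rewrite (hsgT Px) !hsgF //; apply: neg.
- by rewrite hmulNx in Pxy; rewrite (hsgT Py) !hsgF //; apply: neg.
- by rewrite hmulNN in Pxy; rewrite (hsgT Pxy) !hsgF //; apply: neg.
Qed.

Lemma sign_set_sqr D P x : sign_set D P -> D x -> P (x * x).
Proof. by move=> [PM _ DP] /DP[] Px; have := PM _ _ Px Px; rewrite ?hmulNN. Qed.

Lemma ordering_sign_set P : is_ordering P -> sign_set [set x | x <> 0] P.
Proof.
move=> [_ PM PI PU]; split.
- by move=> x y Px Py; apply: PM; exists x => //; exists y.
- move=> x Px; split; first by rewrite -PU; left.
  move=> PNx; suff : (P `&` [set - x | x in P]) x by rewrite PI.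
  by split=> //; exists (- x) => //; rewrite hoppK.
- move=> x; rewrite -PU => -[|[y Py <-]]; first by left.
  by right; rewrite hoppK.
Qed.

Lemma ordering_add P x y z : is_ordering P -> P x -> P y -> (x + y)%H z -> P z.
Proof. by move=> [PD _ _ _] Px Py xyz; apply: PD; exists x => //; exists y. Qed.

Lemma sign_set_ordering P : sign_set [set x | x <> 0] P ->
  (forall x y z, P x -> P y -> (x + y)%H z -> P z) -> is_ordering P.
Proof.
move=> [PM PD DP] Padd; split.
- by move=> z [x Px [y Py xyz]]; apply: Padd xyz.
- by move=> _ [x Px [y Py <-]]; apply: PM.
- by rewrite -subset0 => _ [/[swap] -[x /PD[_ nPx] <-]].
- apply/seteqP; split=> x.
    by case=> [/PD[]//|[y /PD[/= y0 _] <-]]; apply: hopp_neq0.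
  by move=> /DP[]; [left|right; exists (- x); rewrite ?hoppK].
Qed.

End HyperfieldArithmetic.

(** * Valuations and their units *)

Section Valued.
Variables (F : hyperfieldType) (G : orderedZmodType) (v : valuation F G).
Local Open Scope hyper_scope.
Implicit Types (x y z w : F) (P T : set F) (Q : set (residue v)).

Local Notation O := (val_ring v).
Local Notation M := (val_ideal v).

(** The valuation with values in the group itself; the value at 0 is a junk
value. *)
Definition val_fin x : G := if v x is Fin g then g else 0%R.

Definition val_unit x : Prop := v x = Fin 0%R.

Lemma val_finE x : x <> 0 -> v x = Fin (val_fin x).
Proof. by move=> x0; rewrite /val_fin; case E : (v x) => //; case: x0; apply/(val_infty v). Qed.

Lemma val_neq0 x g : v x = Fin g -> x <> 0.
Proof. by move=> xg x0; rewrite x0 val0 in xg. Qed.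

Lemma val_finM x y : x <> 0 -> y <> 0 -> val_fin (x * y) = (val_fin x + val_fin y)%R.
Proof. by move=> x0 y0; rewrite {1}/val_fin val_mul !val_finE. Qed.

Lemma val_finV x : x <> 0 -> val_fin (hinv x) = (- val_fin x)%R.
Proof.
move=> x0; apply/eqP; rewrite -addr_eq0 addrC -val_finM //; last exact: hinv_neq0.
by rewrite hmulxV // /val_fin Defs.val1.
Qed.

Lemma val_finN x : val_fin (- x) = val_fin x.
Proof. by rewrite /val_fin val_opp. Qed.

Lemma val_unitP x : val_unit x <-> x <> 0 /\ val_fin x = 0%R.
Proof.
split=> [xu|[x0 x0']]; last by rewrite /val_unit val_finE // x0'.
by split; [apply: val_neq0 xu|rewrite /val_fin xu].
Qed.

Lemma val_unit_ring x : val_unit x -> O x.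
Proof. by rewrite /val_ring /= => ->; rewrite /=. Qed.

Lemma val_unit_nideal x : O x -> ~ M x -> val_unit x.
Proof.
rewrite /val_ring /val_ideal /val_unit /=; case: (v x) => [a|] //= a0.
by rewrite lt_def a0 andbT => /negP; rewrite negbK => /eqP ->.
Qed.

Lemma val_unit_notideal x : val_unit x -> ~ M x.
Proof. by rewrite /val_ideal /= => ->; rewrite /= ltxx. Qed.

Lemma val_unitN x : val_unit x -> val_unit (- x).
Proof. by rewrite /val_unit val_opp. Qed.

Lemma val_unitM x y : val_unit x -> val_unit y -> val_unit (x * y).
Proof. by rewrite /val_unit val_mul => -> ->; rewrite /= addr0. Qed.

Lemma val_unitV x : val_unit x -> val_unit (hinv x).
Proof.
by move=> /val_unitP[x0 xu]; apply/val_unitP; split; [apply: hinv_neq0|rewrite val_finV // xu oppr0].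
Qed.

(** A linearly ordered group has no 2-torsion. *)
Lemma ozmod_double_eq0 (a : G) : (a + a = 0 -> a = 0)%R.
Proof.
move=> aa0; have [a0|a0] := orP (ozmod_total 0%R a); apply/eqP; rewrite eq_le.
  by have := ozmod_le_add2l a a0; rewrite aa0 addr0 a0 => ->.
by have := ozmod_le_add2l a a0; rewrite aa0 addr0 a0 => ->.
Qed.

Lemma val_unit_sqr x : val_unit (x * x) -> val_unit x.
Proof.
rewrite /val_unit val_mul; case: (v x) => [a|] //= -[/ozmod_double_eq0 ->] //.
Qed.

(** * A section of the valuation up to squares *)

(** The image of p is a complement of the units modulo squares; it exists because
the nonzero elements modulo squares form a vector space over the field with two
elements. *)
Lemma sqr_section : value_group v = [set: G] ->
  exists p : G -> F, (forall g, v (p g) = Fin g) /\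
    forall g h, exists w, p g * p h = p (g + h)%R * (w * w).
Proof.
move=> vG.
pose sqr := [set w * w | w in [set w : F | w <> 0]].
(* Being good must hold for the empty set, the union of the empty chain, hence
   the restriction to nonempty S in the first clause. *)
pose good (S : set F) := [/\ S !=set0 -> sqr `<=` S, forall x, S x -> x <> 0,
  forall x y, S x -> S y -> S (x * y) & forall x, S x -> val_unit x -> sqr x].
have [S [[Ssqr S0 SM SU] Smax]] : exists S, good S /\ forall B, S `<` B -> ~ good B.
  apply: Zorn_bigcup => C Cgood Ctot; split.
  - move=> [x [X CX Xx]] y sy; exists X => //.
    by have [+ _ _ _] := Cgood _ CX; apply=> //; exists x.
  - by move=> x [X /Cgood[_ X0 _ _] /X0].
  - move=> x y [X CX Xx] [Y CY Yy].
    have [_ _ XM _] := Cgood _ CX; have [_ _ YM _] := Cgood _ CY.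
    by have [XY|YX] := Ctot _ _ CX CY; [exists Y|exists X] => //;
      [apply: YM => //; apply: XY|apply: XM => //; apply: YX].
  - by move=> x [X /Cgood[_ _ _ XU] /XU].
have sqr1 : sqr 1 by exists 1; [exact: hone_neq0|rewrite hmul1x].
have sqrM x y : sqr x -> sqr y -> sqr (x * y).
  move=> [a a0 <-] [b b0 <-]; exists (a * b); first exact: hmul_neq0.
  by rewrite hmulACA.
have S_sqr : sqr `<=` S.
  have [/Ssqr//|Snil] := pselect (S !=set0).
  case: (Smax sqr); last first.
    by split=> [_ y //|x [w w0 <-]|//|//]; apply: hmul_neq0.
  split=> [x Sx|sqrS]; first by case: Snil; exists x.
  by apply: Snil; exists 1; apply: sqrS.
(* x^-1 = x * (x^-1)^2 *)
have SV x : S x -> S (hinv x).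
  move=> Sx; have Vx := hinv_neq0 (S0 _ Sx).
  rewrite -(hmulKV (hinv x) (S0 _ Sx)); apply: SM => //; apply: S_sqr.
  by exists (hinv x).
have vS g : exists x, S x /\ v x = Fin g.
  have [x x0 xg] : value_group v g by rewrite vG.
  (* Otherwise S `|` x S is a strictly larger good set: a unit x s would give
     g = v x = v (s^-1) with s^-1 in S. *)
  apply/not_existsP => nS.
  have nSx y : S y -> val_fin y <> g.
    by move=> Sy yg; apply: (nS y); split=> //; rewrite val_finE ?yg //; apply: S0.
  apply: (Smax (S `|` [set x * s | s in S])).
    split; first by move=> y; left.
    move=> sub; have Sx : S x.
      by apply: sub; right; exists 1; [apply: S_sqr|rewrite hmulx1].
    by apply: (nSx _ Sx); rewrite /val_fin xg.
  split.
  - by move=> _ y sy; left; apply: S_sqr.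
  - by move=> y [/S0//|[s /S0 s0 <-]]; apply: hmul_neq0.
  - have Sxx : S (x * x) by apply: S_sqr; exists x.
    move=> y z [Sy|[s Ss <-]] [Sz|[t St <-]].
    + by left; apply: SM.
    + by right; exists (y * t); [apply: SM|rewrite !hmulA (hmulC x)].
    + by right; exists (s * z); [apply: SM|rewrite hmulA].
    + by left; rewrite hmulACA; apply: (SM _ _ Sxx); apply: SM.
  - move=> y [/SU//|[s Ss <-]] /val_unitP[_].
    rewrite val_finM //; last exact: S0.
    move=> /eqP; rewrite addr_eq0 -val_finV; last exact: S0.
    by move=> /eqP E; case: (nSx _ (SV _ Ss)); rewrite -E /val_fin xg.
have [p pS] := choice vS; exists p; split=> [g|g h]; first by have [] := pS g.
have [[Sg vg] [Sh vh] [Sgh vgh]] := And3 (pS g) (pS h) (pS (g + h)%R).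
have [|w _ ww] := SU (hinv (p (g + h)%R) * (p g * p h)) (SM _ _ (SV _ Sgh) (SM _ _ Sg Sh)).
  have [g0 h0 gh0] := And3 (S0 _ Sg) (S0 _ Sh) (S0 _ Sgh).
  apply/val_unitP; split.
    by apply: hmul_neq0; [apply: hinv_neq0|apply: hmul_neq0].
  rewrite !val_finM //; [|exact: hinv_neq0|exact: hmul_neq0].
  by rewrite val_finV // /val_fin vg vh vgh addNr.
by exists w; rewrite ww hmulKV //; apply: S0.
Qed.

(** * Orderings of the residue hyperfield *)

Lemma residue_addP x y (Ox : O x) (Oy : O y) (C : residue v) :
  (residue_class Ox + residue_class Oy)%H C <->
  exists z (Oz : O z), (x + y)%H z /\ C = residue_class Oz.
Proof. by rewrite /hadd /= residue_addE. Qed.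

Definition residue_pos Q : set F := [set x | exists Ox : O x, Q (residue_class Ox)].

Definition residue_image P : set (residue v) :=
  [set C | exists x (Ox : O x), [/\ P x, val_unit x & C = residue_class Ox]].

Lemma residue_posE Q x (Ox : O x) : residue_pos Q x <-> Q (residue_class Ox).
Proof.
split=> [[Ox' Qx]|]; last by exists Ox.
by rewrite (residue_class_irr Ox Ox').
Qed.

Lemma residue_class_eq0 x (Ox : O x) : residue_class Ox = 0 <-> M x.
Proof. by split=> [/residue_class_eq/residue_eqv0|Mx]; last apply/residue_class_eq/residue_eqv0. Qed.

Lemma residue_pos_sign_set Q : is_ordering Q -> sign_set val_unit (residue_pos Q).
Proof.
move=> /ordering_sign_set[QM QD DQ]; split.
- move=> x y [Ox Qx] [Oy Qy]; exists (val_ringM Ox Oy).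
  by rewrite -residue_mulE; apply: QM.
- move=> x [Ox /QD[x0 nQ]]; split.
    by apply: val_unit_nideal => // Mx; apply/x0/residue_class_eq0.
  by move=> [ONx]; rewrite (residue_class_irr ONx (val_ringN Ox)) -residue_oppE.
- move=> x xu; have Ox := val_unit_ring xu.
  have [|Qx|Qx] := DQ (residue_class Ox); last 2 first.
  + by left; exists Ox.
  + by right; exists (val_ringN Ox); rewrite -residue_oppE.
  by move=> /residue_class_eq0; apply: val_unit_notideal.
Qed.

Lemma residue_pos_add Q x y z : is_ordering Q ->
  residue_pos Q x -> residue_pos Q y -> (x + y)%H z -> residue_pos Q z.
Proof.
move=> Qord [Ox Qx] [Oy Qy] xyz; have Oz := val_ringD Ox Oy xyz.
exists Oz; apply: (ordering_add Qord Qx Qy).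
by apply/residue_addP; exists z, Oz.
Qed.

Lemma residue_pos1 Q : is_ordering Q -> residue_pos Q 1.
Proof.
move=> Qord; rewrite -(hmul1x 1).
by apply: (sign_set_sqr (residue_pos_sign_set Qord)); apply: Defs.val1.
Qed.

(** Elements of 1 + m with m of positive valuation have residue class 1. *)
Lemma residue_pos_oneD Q m w : is_ordering Q -> M m -> (1 + m)%H w -> residue_pos Q w.
Proof.
move=> Qord Mm mw; have Ow := val_ringD (val_ring1 v) (val_idealW Mm) mw.
exists Ow; have [O1 Q1] := residue_pos1 Qord.
suff -> : residue_class Ow = residue_class O1 by [].
by apply/residue_class_eq; exists m; split=> //; apply: hadd_rev.
Qed.

(** A sign on the nonzero elements that induces an ordering on residue classes
is additive for free.  If v x <= v y then x + y = x (1 + t) with t = y / x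
positive and integral.  If v t > 0 then 1 + t has residue class 1; if v t = 0
then the classes of 1 and t lie in Q, hence so do those of 1 + t. *)
Lemma ordering_of_sign_set T Q : is_ordering Q ->
    sign_set [set x | x <> 0] T ->
    (forall x, val_unit x -> T x -> residue_pos Q x) ->
  [/\ is_ordering T, compatible v T & residue_image T = Q].
Proof.
move=> Qord Tsgn TQ; have [TM TD DT] := Tsgn.
have Qsgn := residue_pos_sign_set Qord; have [_ QD _] := Qsgn.
have QT x : residue_pos Q x -> T x.
  move=> Qx; have [xu nQx] := QD _ Qx.
  have [//|TNx] := DT _ (val_neq0 xu).
  by case: nQx; apply: TQ => //; apply: val_unitN.
have one t w : O t -> T t -> (1 + t)%H w -> T w.
  move=> Ot Tt tw; apply: QT; case: (pselect (M t)) => [Mt|nMt].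
    exact: residue_pos_oneD tw.
  apply: residue_pos_add tw => //; first exact: residue_pos1.
  by apply: TQ => //; apply: val_unit_nideal.
have add x y z : (val_fin x <= val_fin y)%R -> T x -> T y -> (x + y)%H z -> T z.
  move=> xy Tx Ty xyz; have [x0 _] := TD _ Tx; have [y0 _] := TD _ Ty.
  have Vx0 := hinv_neq0 x0.
  have TVx : T (hinv x).
    rewrite -(hmulKV (hinv x) x0); apply: TM => //; exact: sign_set_sqr Tsgn _.
  have zw := hmulDl_mem (hinv x) xyz.
  rewrite (hmulC _ x) hmulxV // in zw.
  rewrite -(hmulKV z x0); apply: (TM _ _ Tx); apply: one zw; last exact: TM.
  rewrite /val_ring /= val_finE /=; last exact: hmul_neq0.
  rewrite val_finM // val_finV //.
  by have := ozmod_le_add2l (- val_fin x)%R xy; rewrite addNr.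
split.
- apply: sign_set_ordering => // x y z Tx Ty xyz.
  have /orP[xy|yx] := ozmod_total (val_fin x) (val_fin y).
    exact: add xyz.
  by rewrite haddC in xyz; apply: add xyz.
- by move=> w [_ -> [m Mm mw]]; apply: QT; apply: residue_pos_oneD mw.
- apply/seteqP; split=> C.
    by move=> [x [Ox [Tx xu ->]]]; apply/residue_posE/TQ.
  have [x [Ox ->]] := residueP C => Qx.
  have {}Qx : residue_pos Q x by exists Ox.
  by exists x, Ox; split; [apply: QT|have [] := QD _ Qx|].
Qed.

(** * The image of a compatible ordering *)

Section Compatible.
Variable P : set F.
Hypotheses (Pord : is_ordering P) (Pv : compatible v P).
Let Psgn := ordering_sign_set Pord.
Let PM : forall x y, P x -> P y -> P (x * y). Proof. by have [] := Psgn. Qed.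

(** a + m = a (1 + m / a), and m / a still has positive valuation. *)
Lemma compatible_add_ideal a m x :
  val_unit a -> P a -> M m -> (a + m)%H x -> P x.
Proof.
move=> au Pa Mm amx; have a0 := val_neq0 au.
have := hmulDl_mem (hinv a) amx; rewrite (hmulC _ a) hmulxV // => h.
rewrite -(hmulKV x a0); apply: PM => //; apply: Pv.
exists 1 => //; exists (hinv a * m) => //.
by apply: val_idealM => //; apply/val_unit_ring/val_unitV.
Qed.

Lemma residue_pos_image x : val_unit x -> residue_pos (residue_image P) x <-> P x.
Proof.
move=> xu; split=> [[Ox [a [Oa [Pa au /residue_class_eq[m [xam Mm]]]]]]|Px].
  by apply: (compatible_add_ideal au Pa Mm); rewrite haddC; apply: hsub_rev.
have Ox := val_unit_ring xu.
by exists Ox, x, Ox.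
Qed.

(** The point of substance is that a sum z of positive units x and y has
nonzero residue class: otherwise - x, which lies in y - z, would be positive. *)
Lemma residue_image_ordering : is_ordering (residue_image P).
Proof.
have [_ PD DP] := Psgn; apply: sign_set_ordering; first split.
- move=> _ _ [x [Ox [Px xu ->]]] [y [Oy [Py yu ->]]].
  exists (x * y), (val_ringM Ox Oy).
  by split; [apply: PM|apply: val_unitM|apply: residue_mulE].
- move=> _ [x [Ox [Px xu ->]]]; split=> /=.
    by move=> /residue_class_eq0; apply: val_unit_notideal.
  have [_ nPx] := PD _ Px; rewrite [- _]residue_oppE => Nx; apply: nPx.
  by apply/residue_pos_image; [exact: val_unitN|exists (val_ringN Ox)].
- move=> C; have [x [Ox ->]] := residueP C => /= x0.
  have xu : val_unit x.
    by apply: val_unit_nideal => // Mx; apply/x0/residue_class_eq0.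
  have [Px|Px] := DP _ (val_neq0 xu); first by left; exists x, Ox.
  right; exists (- x), (val_ringN Ox).
  by split=> //; [exact: val_unitN|exact: residue_oppE].
- move=> _ _ C [x [Ox [Px xu ->]]] [y [Oy [Py yu ->]]].
  move=> /residue_addP[z [Oz [xyz ->]]].
  exists z, Oz; split=> //; first exact: ordering_add xyz.
  apply: val_unit_nideal => // Mz.
  have [_ nPx] := PD _ Px; apply: nPx.
  apply: (compatible_add_ideal yu Py (val_idealN Mz)).
  by have := hoppD (hadd_revr xyz); rewrite hoppK haddC.
Qed.

End Compatible.

(** * The bijection *)

Section BaerKrull.
Variable p : G -> F.
Hypotheses (vp : forall g, v (p g) = Fin g)
  (pD : forall g h, exists w, p g * p h = p (g + h)%R * (w * w)).

Let p0 g : p g <> 0. Proof. exact: val_neq0 (vp g). Qed.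

Definition unit_part x : F := hinv (p (val_fin x)) * x.

Lemma unit_partK x : p (val_fin x) * unit_part x = x.
Proof. exact: hmulKV. Qed.

Lemma unit_part_unit x : x <> 0 -> val_unit (unit_part x).
Proof.
move=> x0; have V0 := hinv_neq0 (@p0 (val_fin x)).
apply/val_unitP; split; first exact: hmul_neq0.
by rewrite val_finM // val_finV // {1}/val_fin vp addNr.
Qed.

(** The factor w of the section property has v (w^2) = 0, hence is a unit. *)
Lemma section_sqr g h : exists2 w, val_unit w & p g * p h = p (g + h)%R * (w * w).
Proof.
have [w E] := pD g h; exists w => //; apply: val_unit_sqr.
have := congr1 v E; rewrite !val_mul !vp /val_unit val_mul.
by case: (v w) => [a|] //= [/esym/eqP]; rewrite -subr_eq0 addrC addrA addNr add0r => /eqP ->.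
Qed.

Lemma unit_partM x y : x <> 0 -> y <> 0 ->
  exists2 w, val_unit w & unit_part (x * y) = (w * w) * (unit_part x * unit_part y).
Proof.
move=> x0 y0; have [w wu E] := section_sqr (val_fin x) (val_fin y).
exists w => //.
have xyE : x * y = p (val_fin x + val_fin y)%R * ((w * w) * (unit_part x * unit_part y)).
  by rewrite -{1}(unit_partK x) -{1}(unit_partK y) hmulACA E -hmulA.
by rewrite {1}/unit_part val_finM // xyE hmulVK.
Qed.

(** The case g = h = 0 of the section property shows that p 0 is itself the
square of a unit. *)
Lemma unit_part_of_unit x : val_unit x -> exists2 w, val_unit w & unit_part x = x * (w * w).
Proof.
move=> /val_unitP[x0 xu].
have [w wu] := section_sqr 0%R 0%R; rewrite addr0 => E.
have pw : p 0%R = w * w by rewrite -[LHS](hmulVK _ (@p0 0%R)) E hmulVK.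
exists (hinv w); first exact: val_unitV.
rewrite /unit_part xu pw hmulC; congr hmul.
have w0 := val_neq0 wu; have ww0 := hmul_neq0 w0 w0.
by rewrite -[RHS](hmulVK _ ww0) hmulACA hmulxV // hmul1x hmulx1.
Qed.

Definition BK_sign Q (chi : G -> int) x : int :=
  (hsg (residue_pos Q) (unit_part x) * chi (val_fin x))%R.

Definition BK_lift Q chi : set F := [set x | x <> 0 /\ BK_sign Q chi x = 1%R].

Definition BK_map P : set (residue v) * (G -> int) :=
  (residue_image P, fun g => hsg P (p g)).

Lemma sign_hom_zero (chi : G -> int) : sign_homs G chi -> chi 0%R = 1%R.
Proof.
move=> [pm /(_ 0%R 0%R)]; rewrite addr0.
by have [->|->] := pm 0%R.
Qed.

Section Lift.
Variables (Q : set (residue v)) (chi : G -> int).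
Hypotheses (Qord : is_ordering Q) (chiH : sign_homs G chi).
Let Qsgn := residue_pos_sign_set Qord.

Lemma BK_signM x y : x <> 0 -> y <> 0 ->
  BK_sign Q chi (x * y) = (BK_sign Q chi x * BK_sign Q chi y)%R.
Proof.
move=> x0 y0; have [w wu E] := unit_partM x0 y0; have [_ chiD] := chiH.
have xu := unit_part_unit x0; have yu := unit_part_unit y0.
rewrite /BK_sign E val_finM // chiD (hsgM Qsgn); last exact: val_unitM.
  rewrite (hsgT (sign_set_sqr Qsgn wu)) mul1r (hsgM Qsgn) //.
  by rewrite mulrACA.
exact: val_unitM.
Qed.

Lemma BK_signN x : x <> 0 -> BK_sign Q chi (- x) = (- BK_sign Q chi x)%R.
Proof.
move=> x0; rewrite /BK_sign.
have -> : unit_part (- x) = - unit_part x by rewrite /unit_part val_finN hmulxN.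
by rewrite val_finN (hsgN Qsgn (unit_part_unit x0)) mulNr.
Qed.

Lemma BK_sign_pm x : BK_sign Q chi x = 1%R \/ BK_sign Q chi x = (-1)%R.
Proof.
rewrite /BK_sign; have [pm _] := chiH.
by case: (hsg_pm (residue_pos Q) (unit_part x)) (pm (val_fin x)) => -> [] ->;
  [left|right|right|left].
Qed.

Lemma BK_lift_sign_set : sign_set [set x | x <> 0] (BK_lift Q chi).
Proof.
split.
- move=> x y [x0 sx] [y0 sy]; split; first exact: hmul_neq0.
  by rewrite BK_signM // sx sy.
- by move=> x [x0 sx]; split=> // -[_]; rewrite BK_signN // sx.
- move=> x /= x0; have [sx|sx] := BK_sign_pm x; first by left.
  by right; split; [apply: hopp_neq0|rewrite BK_signN // sx opprK].
Qed.

Lemma BK_liftP :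
  [/\ is_ordering (BK_lift Q chi), compatible v (BK_lift Q chi)
    & residue_image (BK_lift Q chi) = Q].
Proof.
apply: ordering_of_sign_set => //; first exact: BK_lift_sign_set.
move=> x xu [_]; have [x0 vx0] := (val_unitP x).1 xu; have [w wu E] := unit_part_of_unit xu.
rewrite /BK_sign E vx0 sign_hom_zero // mulr1 (hsgM Qsgn) //; last exact: val_unitM.
by rewrite (hsgT (sign_set_sqr Qsgn wu)) mulr1 => /hsg1.
Qed.

Lemma BK_lift_section g : hsg (BK_lift Q chi) (p g) = chi g.
Proof.
have E : BK_sign Q chi (p g) = chi g.
  rewrite /BK_sign /unit_part /val_fin vp hmulC hmulxV // hsgT ?mul1r //.
  exact: residue_pos1.
have [pm _] := chiH; have [chi1|chiN] := pm g.
  by rewrite hsgT ?chi1 //; split; rewrite ?E.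
by rewrite hsgF ?chiN // => -[_]; rewrite E chiN.
Qed.

End Lift.

Lemma BK_map_bij :
  set_bij (compatible_orderings v) (orderings (residue v) `*` sign_homs G) BK_map.
Proof.
split.
- move=> P [Pord Pv]; split; first exact: residue_image_ordering.
  have Psgn := ordering_sign_set Pord.
  split=> [g|g h] /=; first exact: hsg_pm.
  have [w wu E] := section_sqr g h; have w0 := val_neq0 wu.
  rewrite -(hsgM Psgn (@p0 g) (@p0 h)) E (hsgM Psgn (@p0 _) (hmul_neq0 w0 w0)).
  by rewrite (hsgT (sign_set_sqr Psgn w0)) mulr1.
- move=> P P' /set_mem[Pord Pv] /set_mem[P'ord P'v] [EQ Echi].
  have Psgn := ordering_sign_set Pord; have P'sgn := ordering_sign_set P'ord.
  have E x : x <> 0 -> hsg P x = hsg P' x.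
    move=> x0; have xu := unit_part_unit x0; have u0 := val_neq0 xu.
    rewrite -(unit_partK x) (hsgM Psgn (@p0 _) u0) (hsgM P'sgn (@p0 _) u0).
    congr (_ * _)%R; first by have := congr1 (@^~ (val_fin x)) Echi.
    rewrite /hsg; congr (if _ then _ else _); apply: asbool_equiv_eq.
    rewrite -(residue_pos_image Pord Pv xu) EQ.
    exact: residue_pos_image.
  have [_ PD _] := Psgn; have [_ P'D _] := P'sgn.
  apply/seteqP; split=> x Px.
    by have [x0 _] := PD _ Px; apply: eq_hsg Px; apply: E.
  by have [x0 _] := P'D _ Px; apply: eq_hsg Px; apply/esym/E.
- move=> [Q chi] [/= Qord chiH].
  have [Tord Tv TQ] := BK_liftP Qord chiH.
  exists (BK_lift Q chi) => //; rewrite /BK_map TQ; congr pair.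
  by apply/funext => g; apply: BK_lift_section.
Qed.

End BaerKrull.
End Valued.

Theorem theorem5p13 (F : hyperfieldType) (Gamma : orderedZmodType)
    (v : valuation F Gamma) :
  is_real F ->
  value_group v = [set: Gamma] ->
  exists f : set F -> set (residue v) * (Gamma -> int),
    set_bij (compatible_orderings v)
            (orderings (residue v) `*` sign_homs Gamma) f.
Proof.
move=> _ /sqr_section[p [vp pD]].
by exists (BK_map v p); apply: BK_map_bij.
Qed.
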